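(* Let $p_{Y|X}$ be a channel from $\mathcal{X}$ to $\mathcal{Y}$, let $x_0\in\mathcal{X}$, let $p_{\tilde X}$ be an arbitrary density on $\mathcal{X}$, let $0\le\tau<1$, and let $$p_X(x)=(1-\tau)\,\delta(x-x_0)+\tau\,p_{\tilde X}(x).$$ Then for every $0\le\rho\le1$, $$\mathcal{E}_0(\rho,p_X,p_{Y|X})\ \ge\ -(1+\rho)\log\left[1-\tau\left(1-e^{-\frac{1}{1+\rho}\mathcal{E}_0(\rho,p_{\tilde X},p_{Y|X})}\right)\right]\ \ge\ (1+\rho)\,\tau\left(1-e^{-\frac{1}{1+\rho}\mathcal{E}_0(\rho,p_{\tilde X},p_{Y|X})}\right).$$
   Context: $\log$ is the natural logarithm and $\delta$ is the Dirac delta (so $p_X$ is the mixture of a unit point mass at $x_0$ with weight $1-\tau$ and $p_{\tilde X}$ with weight $\tau$). For an input distribution $p_X$ on $\mathcal{X}$, Gallager's function is $$\mathcal{E}_0(\rho,p_X,p_{Y|X})=-\log\int_{\mathcal{Y}}\left\{\int_{\mathcal{X}}p_X(x)\left[p_{Y|X}(y|x)\right]^{\frac{1}{1+\rho}}dx\right\}^{1+\rho}dy.$$ Here, as in the discrete case, integrals are replaced by sums when the alphabets are discrete. *)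

(* Defs.v *)
From HB Require Import structures.
From mathcomp Require Import all_boot all_order all_algebra.
From mathcomp Require Import all_classical all_reals all_analysis.

Set Implicit Arguments.
Unset Strict Implicit.
Unset Printing Implicit Defensive.

Import Order.TTheory GRing.Theory Num.Theory.
Import numFieldNormedType.Exports.

Local Open Scope classical_set_scope.
Local Open Scope ring_scope.
Local Open Scope ereal_scope.

(* The measure [nu] on the output alphabet plays the role of [dy]: Lebesgue
   measure for a continuous alphabet, counting measure for a discrete one.
   [W x y] is the conditional density (or mass function) p_{Y|X}(y|x). *)
Definition is_channel d d' (X : measurableType d) (Y : measurableType d')
    (R : realType) (nu : {measure set Y -> \bar R}) (W : X -> Y -> R) : Prop :=
  [/\ (forall x y, (0 <= W x y)%R),
      measurable_fun [set: X * Y] (fun xy : X * Y => W xy.1 xy.2) &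
      forall x, \int[nu]_y (W x y)%:E = 1].

(* The input distribution is a probability measure, so that it may have atoms:
   [\int[P]_x f x] stands for the integral of p_X(x) f(x) dx.
   Taking values in [\bar R], with [lne 0 = -oo] and [lne +oo = +oo], avoids
   presupposing that the outer integral is positive and finite. *)
Definition gallager_E0 d d' (X : measurableType d) (Y : measurableType d')
    (R : realType) (nu : {measure set Y -> \bar R}) (rho : R)
    (P : probability X R) (W : X -> Y -> R) : \bar R :=
  - lne (\int[nu]_y
      poweR (\int[P]_x (powR (W x y) (1 / (1 + rho)))%:E) (1 + rho)).

Section spike_mixture.
Context d (X : measurableType d) (R : realType) (tau : R).
Hypotheses (tau_ge0 : (0 <= tau)%R) (tau_lt1 : (tau < 1)%R).
Variables (x0 : X) (Q : probability X R).

Lemma spike_weight_ge0 : (0 <= 1 - tau)%R.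
Proof. by rewrite subr_ge0 ltW. Qed.

Definition spike_mixture : set X -> \bar R :=
  measure_add (mscale (NngNum spike_weight_ge0) (\d_x0))
              (mscale (NngNum tau_ge0) Q).

HB.instance Definition _ := Measure.on spike_mixture.

Lemma spike_mixtureE (A : set X) :
  spike_mixture A = (1 - tau)%:E * \d_x0 A + tau%:E * Q A.
Proof. by rewrite /spike_mixture measure_addE. Qed.

Let spike_mixture_setT : spike_mixture [set: X] = 1.
Proof.
rewrite spike_mixtureE diracT [X in _ + _ * X]probability_setT.
by rewrite !mule1 -EFinD subrK.
Qed.

HB.instance Definition _ :=
  Measure_isProbability.Build _ _ _ spike_mixture spike_mixture_setT.

End spike_mixture.

(* Main.v *)
(* With p = 1 + rho, the quantity exp (- E0(rho, P, W) / p) is the L^p(nu) norm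
   of the P-average of W^(1/p).  For the spike mixture this average is
   (1 - tau) W(x0, .)^(1/p) + tau g, where g is the Q-average, and
   W(x0, .)^(1/p) has L^p norm 1, so the first inequality is Minkowski's.
   The second one is ln (1 - t) <= - t.

   Since nu need not be sigma-finite, Tonelli does not apply and the norm of g
   may be infinite; hence the norms are handled in \bar R. *)

Require Import Defs.
From HB Require Import structures.
From mathcomp Require Import all_boot all_order all_algebra.
From mathcomp Require Import all_classical all_reals all_analysis.
From mathcomp Require Import measurable_realfun ring.

Set Implicit Arguments.
Unset Strict Implicit.
Unset Printing Implicit Defensive.

Import Order.TTheory GRing.Theory Num.Theory.
Import numFieldNormedType.Exports.

Local Open Scope classical_set_scope.
Local Open Scope ring_scope.
Local Open Scope ereal_scope.

(** At the endpoints 0 and +oo it is r > 0 that makes both sides agree: r * [lne x] is then -oo or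
    +oo, with exponential 0 or +oo. *)
Lemma poweRE_expeR (R : realType) (x : \bar R) (r : R) :
  (0 < r)%R -> 0 <= x -> poweR x r = expeR (r%:E * lne x).
Proof.
move=> r0; case: x => [x||]// x0; last by rewrite poweRyr ?gt_eqF// gt0_muley.
move: x0; rewrite lee_fin le_eqVlt => /predU1P[<-|x0].
  by rewrite poweR0r ?gt_eqF// le0_lneNy// gt0_muleNy.
by rewrite lne_EFin//= /powR gt_eqF.
Qed.

Lemma lne_poweR (R : realType) (x : \bar R) (r : R) :
  (0 < r)%R -> 0 <= x -> lne (poweR x r) = r%:E * lne x.
Proof. by move=> r0 x0; rewrite poweRE_expeR// expeRK. Qed.

Section Lnorm_ereal.
Context d (T : measurableType d) (R : realType).
Variable mu : {measure set T -> \bar R}.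
Implicit Types (f g : T -> \bar R) (p c : R).

Lemma ge0_LnormE f p : (forall x, 0 <= f x) ->
  'N[mu]_p%:E[f] = poweR (\int[mu]_x (poweR (f x) p)) p^-1.
Proof.
move=> f0; rewrite unlock; congr poweR.
by apply: eq_integral => x _; rewrite gee0_abs.
Qed.

Lemma ge0_Lnorm_scale f p c : measurable_fun [set: T] f ->
  (forall x, 0 <= f x) -> (0 <= c)%R -> (0 < p)%R ->
  Lnorm mu p%:E (fun x => c%:E * f x) = c%:E * 'N[mu]_p%:E[f].
Proof.
move=> mf f0 c0 p0; rewrite !ge0_LnormE//; last by move=> x; exact: mule_ge0.
under eq_integral do rewrite poweRM//.
rewrite ge0_integralZl//; last first.
- exact: poweR_ge0.
- by move=> x _; exact: poweR_ge0.
- exact: (measurableT_comp (measurable_poweR p)).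
rewrite poweRM ?poweR_ge0//; last by apply: integral_ge0 => x _; exact: poweR_ge0.
by rewrite -poweRrM mulfV ?gt_eqF// poweRe1.
Qed.

Lemma ae_eq_Lnorm f g p : measurable_fun [set: T] f ->
  measurable_fun [set: T] g -> f = g %[ae mu] -> 'N[mu]_p%:E[f] = 'N[mu]_p%:E[g].
Proof.
have mN h : measurable_fun [set: T] h ->
    measurable_fun [set: T] (fun x => poweR `|h x| p).
  move=> mh; apply: (measurableT_comp (measurable_poweR p)).
  exact: measurableT_comp.
move=> mf mg fg; rewrite unlock; congr poweR.
apply: ge0_ae_eq_integral => //.
- exact: mN.
- exact: mN.
- by move=> x _; exact: poweR_ge0.
- by move=> x _; exact: poweR_ge0.
- by apply: filterS fg => x /= + xT; move=> ->.
Qed.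

(** A finite norm makes |f|^p integrable, hence a.e. finite; as p > 0, this power is +oo wherever f
    is infinite. *)
Lemma Lnorm_lty_ae_fine f p : measurable_fun [set: T] f -> (0 < p)%R ->
  'N[mu]_p%:E[f] < +oo -> f = EFin \o (fine \o f) %[ae mu].
Proof.
move=> mf p0; rewrite unlock => /lty_poweRy - /(_ _) h.
have : mu.-integrable [set: T] (fun x => poweR `|f x| p).
  apply/integrableP; split.
    apply: (measurableT_comp (measurable_poweR p)).
    exact: measurableT_comp.
  under eq_integral do rewrite gee0_abs ?poweR_ge0//.
  by apply: h; rewrite invr_eq0 gt_eqF.
move=> /(integrable_ae measurableT); apply: filterS => x /= /(_ I) + _.
by case: (f x) => //=; rewrite gt_eqF.
Qed.

(* A function of finite norm is a.e. finite, hence a.e. equal to a real-valued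
   one, which reduces the claim to [minkowski_EFin]. *)
Lemma minkowski_ereal f g p :
  measurable_fun [set: T] f -> measurable_fun [set: T] g ->
  (1 <= p)%R ->
  'N[mu]_p%:E[f \+ g] <= 'N[mu]_p%:E[f] + 'N[mu]_p%:E[g].
Proof.
move=> mf mg p1; have p0 : (0 < p)%R by exact: lt_le_trans p1.
(* An infinite norm makes the right-hand side +oo, because the other norm is nonnegative and so
   cannot be -oo. *)
have [->|foo] := eqVneq 'N[mu]_p%:E[f] +oo.
  by rewrite addye ?leey// -ltNye (lt_le_trans _ (Lnorm_ge0 _ _ _)).
have [->|goo] := eqVneq 'N[mu]_p%:E[g] +oo.
  by rewrite addey ?leey// -ltNye (lt_le_trans _ (Lnorm_ge0 _ _ _)).
have mff : measurable_fun [set: T] (fine \o f) by exact: measurableT_comp.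
have mfg : measurable_fun [set: T] (fine \o g) by exact: measurableT_comp.
have ff := Lnorm_lty_ae_fine mf p0 (ltac:(by rewrite ltey)).
have fg := Lnorm_lty_ae_fine mg p0 (ltac:(by rewrite ltey)).
have mE (h : T -> R) : measurable_fun [set: T] h ->
    measurable_fun [set: T] (EFin \o h).
  by move=> mh; exact/measurable_EFinP.
rewrite (ae_eq_Lnorm p mf (mE _ mff) ff) (ae_eq_Lnorm p mg (mE _ mfg) fg).
rewrite (@ae_eq_Lnorm _ (EFin \o ((fine \o f) \+ (fine \o g))%R)).
- exact: minkowski_EFin.
- exact: emeasurable_funD.
- by apply: mE; exact: measurable_funD.
by apply: filterS2 ff fg => x /= fx gx xT; rewrite EFinD -fx// -gx.
Qed.

End Lnorm_ereal.

Lemma integral_spike_mixture d (X : measurableType d) (R : realType) (tau : R)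
    (tau_ge0 : (0 <= tau)%R) (tau_lt1 : (tau < 1)%R) (x0 : X)
    (Q : probability X R) (f : X -> \bar R) :
  measurable_fun [set: X] f -> (forall x, 0 <= f x) ->
  \int[spike_mixture tau_ge0 tau_lt1 x0 Q]_x f x =
  (1 - tau)%:E * f x0 + tau%:E * \int[Q]_x f x.
Proof.
move=> mf f0; rewrite ge0_integral_measure_add// !ge0_integral_mscale//=.
by rewrite integral_dirac// diracT mul1e.
Qed.

(** The outer integral is the p-th power of the L^p norm with p = 1 + rho, and [lne] turns that
    power into a factor, even for a norm equal to 0 or +oo. *)
Lemma gallager_E0_Lnorm d d' (X : measurableType d) (Y : measurableType d')
    (R : realType) (nu : {measure set Y -> \bar R}) (W : X -> Y -> R)
    (P : probability X R) (rho : R) : (0 <= rho)%R ->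
  gallager_E0 nu rho P W =
  - ((1 + rho)%:E * lne (Lnorm nu (1 + rho)%:E
    (fun y => \int[P]_x (powR (W x y) (1 / (1 + rho)))%:E))).
Proof.
move=> rho0; have p0 : (0 < 1 + rho)%R by rewrite ltr_pwDl.
rewrite /gallager_E0 -lne_poweR ?Lnorm_ge0// poweR_Lnorm ?gt_eqF//.
congr (- lne _); apply: eq_integral => y _; rewrite gee0_abs//.
by apply: integral_ge0 => x _; rewrite lee_fin powR_ge0.
Qed.

Theorem lemma2 (R : realType) (d d' : measure_display)
    (X : measurableType d) (Y : measurableType d')
    (nu : {measure set Y -> \bar R}) (W : X -> Y -> R)
    (hW : is_channel nu W)
    (x0 : X) (Q : probability X R)
    (tau : R) (tau_ge0 : (0 <= tau)%R) (tau_lt1 : (tau < 1)%R)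
    (rho : R) (rho_ge0 : (0 <= rho)%R) (rho_le1 : (rho <= 1)%R) :
  let PX : probability X R := spike_mixture tau_ge0 tau_lt1 x0 Q in
  let t : \bar R :=
    tau%:E * (1 - expeR (- ((1 / (1 + rho))%:E * gallager_E0 nu rho Q W))) in
  gallager_E0 nu rho PX W >= - ((1 + rho)%:E * lne (1 - t)) /\
  - ((1 + rho)%:E * lne (1 - t)) >= (1 + rho)%:E * t.
Proof.
case: hW => W0 mW W1 PX t.
set p := (1 + rho)%R in t *.
have p1 : (1 <= p)%R by rewrite lerDl.
have p0 : (0 < p)%R by exact: lt_le_trans p1.
pose V x y : R := powR (W x y) (1 / p).
have V0 x y : 0 <= (V x y)%:E by rewrite lee_fin powR_ge0.
have mV : measurable_fun [set: X * Y] (fun xy : X * Y => (V xy.1 xy.2)%:E).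
  by apply/measurable_EFinP; exact: (measurableT_comp (measurable_powR (1 / p)) mW).
pose f y := (V x0 y)%:E.
pose g y := \int[Q]_x (V x y)%:E.
have mf : measurable_fun [set: Y] f.
  exact: (measurableT_comp mV (pair1_measurable x0)).
have mg : measurable_fun [set: Y] g.
  exact: (measurable_fun_fubini_tonelli_G (m1 := Q) _ mV).
have f0 y : 0 <= f y by exact: V0.
have g0 y : 0 <= g y by exact: integral_ge0.
pose N := 'N[nu]_p%:E[g].
have N0 : 0 <= N by exact: Lnorm_ge0.
(* The p-th power of f is W(x0, .), which integrates to 1 because W is a channel. *)
have Nf : 'N[nu]_p%:E[f] = 1.
  rewrite ge0_LnormE//.
  under eq_integral do
    rewrite /f /V poweR_EFin -powRrM div1r mulVf ?gt_eqF// powRr1//.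
  by rewrite W1 poweR1r.
(* The exponential in t is N itself: the factors 1/p and p cancel, and [expeR] inverts [lne] on
   [0, +oo]. *)
have tE : t = tau%:E * (1 - N).
  rewrite /t gallager_E0_Lnorm// -/p -/N muleN oppeK muleA -EFinM.
  by rewrite div1r mulVf ?gt_eqF// mul1e lneK// in_itv/= N0 leey.
have onet : 1 - t = (1 - tau)%:E + tau%:E * N.
  rewrite tE; move: N0; clear tE; case: N => [n||]// _.
    by rewrite -!(EFinD,EFinM,EFinN); congr EFin; ring.
  (* Here N = +oo. If tau = 0, the convention 0 * oo = 0 makes both sides 1; if tau > 0, then t =
     -oo and both sides are +oo. *)
  have [<-|tau0] := predU1P (eqbLR (le_eqVlt _ _) tau_ge0).
    by rewrite !mul0e !subr0 sube0 adde0.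
  by rewrite !gt0_muley// gt0_muleNy.
have s0 : 0 <= 1 - t.
  by rewrite onet adde_ge0 ?mule_ge0// lee_fin subr_ge0 ltW.
split.
  rewrite gallager_E0_Lnorm// -/p leeN2 lee_pmul2l//.
  rewrite lee_lne ?in_itv/= ?leey ?andbT ?Lnorm_ge0//.
  rewrite (_ : (fun y => _) =
      (fun y => (1 - tau)%:E * f y) \+ (fun y => tau%:E * g y)); last first.
    apply/funext => y /=; rewrite integral_spike_mixture//;
      last exact: (V0^~ y).
    exact: (measurableT_comp mV (pair2_measurable y)).
  have tau'0 : (0 <= 1 - tau)%R by exact: spike_weight_ge0.
  (* The lone 1 - tau is read as (1 - tau) times the norm of f, so that the bound becomes a sum of
     two norms as in Minkowski's inequality. *)
  rewrite onet -[X in X + _]mule1 -Nf -!ge0_Lnorm_scale//.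
  by apply: minkowski_ereal => //; exact: measurable_funeM.
rewrite leeNr -[- (p%:E * _)]muleN lee_pmul2l//.
(* The logarithm bound at -t requires -1 <= -t, which is [s0] rearranged; -t may be +oo. *)
by apply: le_lne1Dx; rewrite leeN2 -sube_ge0// orbT.
Qed.
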